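(* Let $p,q:[a,\infty)\to(0,\infty)$ be continuous, $a\ge 0$, and consider the equation (A): $(p(t)x')'=q(t)x$. Assume that $\int_a^\infty\frac{dt}{p(t)}=\infty$ and $\int_a^\infty q(t)\,dt<\infty$, and put $P(t)=\int_a^t\frac{ds}{p(s)}$, $\rho(t)=\int_t^\infty q(s)\,ds$. Suppose that $$\int_a^\infty q(t)P(t)\,dt=\infty\qquad\Bigl(\text{or equivalently } \int_a^\infty\frac{\rho(t)}{p(t)}\,dt=\infty\Bigr)$$ and that there is a constant $\gamma\in(0,1)$ such that $$\int_a^t q(s)P(s)^2\,ds\le\gamma P(t)\quad\text{for all large } t.$$ Then (A) possesses a positive growing extreme solution $x(t)$, i.e. a positive solution satisfying $x(\infty)=Dx(\infty)=\infty$.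
   Context: Solutions of (A) are nontrivial real solutions defined on some interval $[T,\infty)$, $T\ge a$. $Dx(t)=p(t)x'(t)$, $x(\infty)=\lim_{t\to\infty}x(t)$, $Dx(\infty)=\lim_{t\to\infty}Dx(t)$. A solution is extreme if either $|x(\infty)|=|Dx(\infty)|=0$ (decaying) or $|x(\infty)|=|Dx(\infty)|=\infty$ (growing). *)

(* Defs.v *)
From Stdlib Require Import Reals.
From Coquelicot Require Import Coquelicot.
Open Scope R_scope.

Definition ray (T : R) : R -> Prop := fun t => T <= t.

(* Meant for nonnegative integrands, for which divergence is divergence
   to +oo. *)
Definition RInt_diverges (f : R -> R) (a : R) : Prop :=
  is_lim (fun t => RInt f a t) p_infty p_infty.

Definition RInt_converges (f : R -> R) (a : R) : Prop :=
  ex_RInt_gen f (at_point a) (Rbar_locally p_infty).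

Definition Pint (p : R -> R) (a t : R) : R := RInt (fun s => / p s) a t.

Definition rho (q : R -> R) (t : R) : R :=
  RInt_gen q (at_point t) (Rbar_locally p_infty).

Definition quasi_derivative (p x' : R -> R) : R -> R := fun t => p t * x' t.

(* x is a nontrivial solution of (p x')' = q x on [T, oo), with derivative x'.
   [D_in f f' D t] is differentiability relative to D, so the derivatives at
   the endpoint T are right derivatives and values outside [T, oo) play no
   role; x' is determined by x on [T, oo). *)
Definition is_solution (p q : R -> R) (T : R) (x x' : R -> R) : Prop :=
  (forall t, T <= t -> D_in x x' (ray T) t) /\
  (forall t, T <= t ->
     D_in (quasi_derivative p x') (fun s => q s * x s) (ray T) t) /\
  (exists t, T <= t /\ x t <> 0).

(* Main.v *)
Require Import Defs.
From Stdlib Require Import Reals Lra Lia.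
From Coquelicot Require Import Coquelicot.
Open Scope R_scope.

(** Write w = 1/p, W(t) for the integral of w from a to t, and y = p x' for the
    quasi-derivative, so that (A) becomes the linear system x' = w y, y' = q x.

    The equivalence of the two divergence conditions is integration by parts.
    Since rho' = -q and W' = w, the integral of rho w over [a,t] equals
    rho(t) W(t) plus the integral of q W over [a,t] ([RInt_tail_by_parts]).
    The boundary term is nonnegative, so divergence of the integral of q W
    forces that of rho w.  Conversely, for s >= t, the integral of q W over
    [a,s] exceeds the one over [a,t] by at least W(t) (rho(t) - rho(s)), hence
    is at least the integral of rho w over [a,t] minus rho(s) W(t).  Fixing a
    large t and letting s tend to infinity, so that rho(s) tends to 0, puts the
    integral of q W above any given bound ([diverges_tail_iff]).

    For the growing solution, let x and y both start with positive values.
    The coefficients w and q are positive, so x and y keep increasing.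
    From y >= 1 follows x >= W, which tends to infinity; feeding this into
    y' = q x gives y >= integral of q W, which tends to infinity by hypothesis
    ([solution_lower_bounds]).

    What remains is the global existence of a solution of the system.  It is
    obtained by Picard iteration: started from the constant 1, the iterates
    increase, and the step from the n-th to the (n+1)-st is at most
    u^(n+1)/(n+1)! with u the integral of w + q ([picard_step]).  So the
    iterates converge uniformly on compact intervals, together with their
    derivatives ([picard_CVU], [is_derive_picard_lim]).

    To have two-sided derivatives at the left endpoint a as well, the
    coefficients are extended by constants to the left of a ([extend]) and the
    iteration is started at a - 1. *)

(** * Integrals of continuous functions *)

Lemma ex_RInt_cont (f : R -> R) (a b : R) :
  (forall t, continuous f t) -> ex_RInt f a b.
Proof. intros cf; apply (ex_RInt_continuous (V:=R_CompleteNormedModule)); intros; apply cf. Qed.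

Lemma is_derive_RInt_cont (f : R -> R) (a t : R) :
  (forall s, continuous f s) -> is_derive (RInt f a) t (f t).
Proof.
  intros cf; apply is_derive_RInt with a; [|apply cf].
  exists (mkposreal 1 Rlt_0_1); intros s _; apply RInt_correct.
  now apply ex_RInt_cont.
Qed.

Lemma is_derive_cont (f : R -> R) (t l : R) : is_derive f t l -> continuous f t.
Proof. intros d; apply (ex_derive_continuous (V:=R_NormedModule)); now exists l. Qed.

Lemma continuous_RInt_cont (f : R -> R) (a : R) :
  (forall t, continuous f t) -> forall t, continuous (RInt f a) t.
Proof. intros cf t; eapply is_derive_cont, is_derive_RInt_cont, cf. Qed.

Lemma continuous_mult_RInt (f g : R -> R) (a : R) :
  (forall t, continuous f t) -> (forall t, continuous g t) ->
  forall t, continuous (fun t => f t * RInt g a t) t.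
Proof.
  intros cf cg t; apply (continuous_mult f); auto using continuous_RInt_cont.
Qed.

Lemma RInt_of_derive (f df : R -> R) (a b : R) : a <= b ->
  (forall t, a <= t -> is_derive f t (df t)) ->
  (forall t, a <= t -> continuous df t) ->
  RInt df a b = f b - f a.
Proof.
  intros ab d c; apply is_RInt_unique.
  apply (is_RInt_derive f df); rewrite Rmin_left by easy;
    intros t [at_ _]; auto.
Qed.

Lemma RInt_cont_nonneg (f : R -> R) (a b : R) : a <= b ->
  (forall t, continuous f t) -> (forall t, a <= t -> 0 <= f t) ->
  0 <= RInt f a b.
Proof.
  intros ab cf f0; apply RInt_ge_0; [easy|now apply ex_RInt_cont|].
  intros t Ht; apply f0; lra.
Qed.

Lemma RInt_cont_le (f g : R -> R) (a b : R) : a <= b ->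
  (forall t, continuous f t) -> (forall t, continuous g t) ->
  (forall t, a <= t -> f t <= g t) -> RInt f a b <= RInt g a b.
Proof.
  intros ab cf cg fg; apply RInt_le; try apply ex_RInt_cont; try easy.
  intros t Ht; apply fg; lra.
Qed.

Lemma RInt_cont_mono (f : R -> R) (a s t : R) : a <= s <= t ->
  (forall t, continuous f t) -> (forall t, a <= t -> 0 <= f t) ->
  RInt f a s <= RInt f a t.
Proof.
  intros Hs cf f0.
  rewrite <- (RInt_Chasles f a s t) by now apply ex_RInt_cont.
  assert (0 <= RInt f s t).
  { apply RInt_cont_nonneg; try easy; intros; apply f0; lra. }
  unfold plus; simpl; lra.
Qed.

Lemma RInt_cont_minus (f g : R -> R) (a b : R) :
  (forall t, continuous f t) -> (forall t, continuous g t) ->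
  RInt (fun t => f t - g t) a b = RInt f a b - RInt g a b.
Proof. intros cf cg; apply (RInt_minus f g); now apply ex_RInt_cont. Qed.

(* The integrals below live in the carrier of a normed module, which [ring]
   does not identify with [R]. *)
Ltac ring_R := match goal with |- ?x = ?y => change (@eq R x y); ring end.

(** * Picard iteration for the system x' = w y, y' = q x *)

Lemma is_derive_exp_term (u : R -> R) (t l : R) (n : nat) : is_derive u t l ->
  is_derive (fun s => u s ^ S n / INR (Factorial.fact (S n))) t
    (l * (u t ^ n / INR (Factorial.fact n))).
Proof.
  intros du.
  assert (e : l = Derive u t) by (symmetry; now apply is_derive_unique).
  rewrite fact_simpl, mult_INR.
  pose proof (not_0_INR (S n) ltac:(lia)).
  set (m := INR (S n)) in *.
  auto_derive; [now exists l|].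
  rewrite e.
  pose proof (INR_fact_neq_0 n). pose proof (pos_INR n).
  replace (Derive (fun x => u x) t) with (Derive u t) by reflexivity.
  simpl pred. change (match n with O => 1 | S _ => INR n + 1 end) with m.
  field; auto.
Qed.

(** The x-component of the n-th iterate for the initial values x(a) = y(a) = 1.
    The system is invariant under exchanging (x, w) with (y, q), so the
    y-component is [picard a n q w], and one recursion, with the
    coefficients swapped at each step, covers both. *)
Fixpoint picard (a : R) (n : nat) (w q : R -> R) (t : R) : R :=
  match n with
  | O => 1
  | S n => 1 + RInt (fun s => w s * picard a n q w s) a t
  end.

Lemma picard_cont (a : R) n : forall w q : R -> R,
  (forall t, continuous w t) -> (forall t, continuous q t) ->
  forall t, continuous (picard a n w q) t.
Proof.
  induction n as [|n IH]; intros w q cw cq t; simpl.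
  - apply continuous_const.
  - apply (continuous_plus (fun _ => 1)); [apply continuous_const|].
    apply continuous_RInt_cont; intros s; apply (continuous_mult w); auto.
Qed.

Lemma continuous_mul_picard (a : R) n (w q : R -> R) :
  (forall t, continuous w t) -> (forall t, continuous q t) ->
  forall t, continuous (fun s => w s * picard a n q w s) t.
Proof. intros cw cq t; apply (continuous_mult w); auto using picard_cont. Qed.

Lemma is_derive_picard (a : R) n (w q : R -> R) t :
  (forall t, continuous w t) -> (forall t, continuous q t) ->
  is_derive (picard a (S n) w q) t (w t * picard a n q w t).
Proof.
  intros cw cq; simpl.
  evar_last.
  - apply (is_derive_plus (fun _ => 1)); [apply is_derive_const|].
    apply (is_derive_RInt_cont (fun s => w s * picard a n q w s)).
    now apply continuous_mul_picard.
  - apply Rplus_0_l.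
Qed.

(** The bound is proved by integrating the previous one: the step for (w, q) is
    the integral of w times the step for (q, w), and w <= w + q = u', so it is at
    most the integral of u' u^n/n!.  Using the swap-invariant u = int (w + q)
    makes the induction hypothesis for (q, w) match. *)
Lemma picard_step (a : R) n : forall (w q : R -> R) t,
  (forall t, continuous w t) -> (forall t, continuous q t) ->
  (forall t, a <= t -> 0 <= w t) -> (forall t, a <= t -> 0 <= q t) ->
  a <= t ->
  0 <= picard a (S n) w q t - picard a n w q t
    <= (RInt w a t + RInt q a t) ^ S n / INR (Factorial.fact (S n)).
Proof.
  induction n as [|n IH]; intros w q t cw cq w0 q0 Ht.
  - simpl picard. rewrite (RInt_ext _ w) by (intros; apply Rmult_1_r).
    pose proof (RInt_cont_nonneg w a t Ht cw w0).
    pose proof (RInt_cont_nonneg q a t Ht cq q0). simpl. lra.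
  - replace (picard a (S (S n)) w q t - picard a (S n) w q t)
      with (RInt (fun s => w s * (picard a (S n) q w s - picard a n q w s)) a t).
    2:{ rewrite (RInt_ext _ (fun s => w s * picard a (S n) q w s
          - w s * picard a n q w s)) by (intros; apply Rmult_minus_distr_l).
        rewrite RInt_cont_minus by now apply continuous_mul_picard.
        change (picard a (S (S n)) w q t)
          with (1 + RInt (fun s => w s * picard a (S n) q w s) a t).
        change (picard a (S n) w q t)
          with (1 + RInt (fun s => w s * picard a n q w s) a t).
        ring_R. }
    assert (cd : forall s,
      continuous (fun s => w s * (picard a (S n) q w s - picard a n q w s)) s).
    { intros s; apply (continuous_mult w); [apply cw|].
      apply (continuous_minus (picard a (S n) q w)); now apply picard_cont. }
    split.
    + apply RInt_cont_nonneg; try easy. intros s Hs.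
      apply Rmult_le_pos; [auto|]. now apply IH.
    + set (u := fun s => RInt w a s + RInt q a s).
      assert (du : forall s, is_derive u s (w s + q s)).
      { intros s; apply (is_derive_plus (RInt w a) (RInt q a));
          now apply is_derive_RInt_cont. }
      assert (u0 : u a = 0) by (unfold u; rewrite !RInt_point; apply Rplus_0_l).
      assert (dU : forall s, is_derive (fun s => u s ^ S (S n) / INR (Factorial.fact (S (S n)))) s
        ((w s + q s) * (u s ^ S n / INR (Factorial.fact (S n))))).
      { intros s; now apply is_derive_exp_term. }
      assert (cU : forall s,
        continuous (fun s => (w s + q s) * (u s ^ S n / INR (Factorial.fact (S n)))) s).
      { intros s. apply (continuous_mult (fun s => w s + q s)).
        - apply (continuous_plus w q); auto.
        - eapply is_derive_cont; now apply is_derive_exp_term. }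
      replace ((RInt w a t + RInt q a t) ^ S (S n) / INR (Factorial.fact (S (S n))))
        with (RInt (fun s => (w s + q s) * (u s ^ S n / INR (Factorial.fact (S n)))) a t).
      * apply RInt_cont_le; try easy. intros s Hs.
        destruct (IH q w s cq cw q0 w0 Hs) as [l r].
        rewrite (Rplus_comm (RInt q a s)) in r. fold (u s) in r.
        pose proof (w0 s Hs). pose proof (q0 s Hs). apply Rmult_le_compat; lra.
      * rewrite (RInt_of_derive (fun s => u s ^ S (S n) / INR (Factorial.fact (S (S n)))))
          by auto.
        rewrite u0, pow_i by lia. unfold u, Rdiv. ring_R.
Qed.


(** Summing the step bounds, the difference of two iterates is at most the
    difference of two partial sums of the series of exp(M), where M is the value
    of u at the right end of the interval. *)
Lemma picard_CVU (a b : R) (w q : R -> R) :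
  (forall t, continuous w t) -> (forall t, continuous q t) ->
  (forall t, a <= t -> 0 <= w t) -> (forall t, a <= t -> 0 <= q t) ->
  CVU_cauchy (fun n => picard a n w q) (fun t => a <= t <= b).
Proof.
  intros cw cq w0 q0.
  set (M := RInt w a b + RInt q a b).
  set (E := sum_f_R0 (fun k => / INR (Factorial.fact k) * M ^ k)).
  assert (tail : forall n m t, a <= t <= b -> (n <= m)%nat ->
    0 <= picard a m w q t - picard a n w q t <= E m - E n).
  { intros n m t Ht nm; induction nm as [|m nm IH]; [lra|].
    destruct (picard_step a m w q t cw cq w0 q0 (proj1 Ht)) as [l r].
    change (E (S m)) with (E m + / INR (Factorial.fact (S m)) * M ^ S m).
    assert ((RInt w a t + RInt q a t) ^ S m <= M ^ S m).
    { pose proof (RInt_cont_nonneg w a t (proj1 Ht) cw w0).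
      pose proof (RInt_cont_nonneg q a t (proj1 Ht) cq q0).
      pose proof (RInt_cont_mono w a t b Ht cw w0).
      pose proof (RInt_cont_mono q a t b Ht cq q0).
      apply pow_incr; unfold M; lra. }
    pose proof (Rinv_0_lt_compat _ (INR_fact_lt_0 (S m))) as f0.
    assert (/ INR (Factorial.fact (S m)) * (RInt w a t + RInt q a t) ^ S m
      <= / INR (Factorial.fact (S m)) * M ^ S m)
      by (apply Rmult_le_compat_l; lra).
    unfold Rdiv in r; rewrite Rmult_comm in r; lra. }
  intros eps.
  destruct (CV_Cauchy E (exist _ _ (proj2_sig (exist_exp M))) eps (cond_pos eps))
    as [N HN].
  exists N; intros n m t Ht Hn Hm.
  specialize (HN n m Hn Hm). unfold R_dist, Rdist in HN.
  destruct (Nat.le_ge_cases n m) as [nm|nm];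
    pose proof (tail _ _ t Ht nm) as T;
    unfold Rabs in *; repeat destruct Rcase_abs; lra.
Qed.

Definition picard_lim (a : R) (w q : R -> R) (t : R) : R :=
  Lim_seq (fun n => picard a n w q t).

Lemma is_lim_seq_picard (a : R) (w q : R -> R) (t : R) :
  (forall t, continuous w t) -> (forall t, continuous q t) ->
  (forall t, a <= t -> 0 <= w t) -> (forall t, a <= t -> 0 <= q t) ->
  a <= t -> is_lim_seq (fun n => picard a n w q t) (picard_lim a w q t).
Proof.
  intros cw cq w0 q0 Ht; apply Lim_seq_correct', ex_lim_seq_cauchy_corr.
  intros eps; destruct (picard_CVU a t w q cw cq w0 q0 eps) as [N HN].
  exists N; intros n m Hn Hm; apply HN; try easy; lra.
Qed.

Lemma picard_lim_ge1 (a : R) (w q : R -> R) (t : R) :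
  (forall t, continuous w t) -> (forall t, continuous q t) ->
  (forall t, a <= t -> 0 <= w t) -> (forall t, a <= t -> 0 <= q t) ->
  a <= t -> 1 <= picard_lim a w q t.
Proof.
  intros cw cq w0 q0 Ht.
  apply (is_lim_seq_le (fun _ => 1) (fun n => picard a n w q t) 1
    (picard_lim a w q t)).
  - induction n as [|n IH]; [simpl; lra|].
    destruct (picard_step a n w q t cw cq w0 q0 Ht); lra.
  - apply is_lim_seq_const.
  - now apply is_lim_seq_picard.
Qed.

(** Uniform convergence passes to the derivatives w * picard a n q w, because w
    is bounded on [a, t+1]; so the limit may be differentiated term by term.
    The index is shifted by one to skip the initial iterate, whose derivative
    is 0 and does not follow the pattern. *)
Lemma is_derive_picard_lim (a : R) (w q : R -> R) (t : R) :
  (forall t, continuous w t) -> (forall t, continuous q t) ->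
  (forall t, a <= t -> 0 <= w t) -> (forall t, a <= t -> 0 <= q t) ->
  a < t -> is_derive (picard_lim a w q) t (w t * picard_lim a q w t).
Proof.
  intros cw cq w0 q0 Ht.
  set (D := fun s => a < s < t + 1).
  assert (DE : forall n s, Derive (picard a (S n) w q) s = w s * picard a n q w s).
  { intros; now apply is_derive_unique, is_derive_picard. }
  apply (is_derive_ext (fun s => real (Lim_seq (fun n => picard a (S n) w q s)))).
  { intros s; unfold picard_lim.
    now rewrite (Lim_seq_incr_1 (fun n => picard a n w q s)). }
  replace (w t * picard_lim a q w t)
    with (real (Lim_seq (fun n => Derive (picard a (S n) w q) t))).
  2:{ rewrite (Lim_seq_ext _ (fun n => w t * picard a n q w t)) by (intros; apply DE).
      rewrite (is_lim_seq_unique _ (w t * picard_lim a q w t)); [easy|].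
      apply (is_lim_seq_scal_l _ (w t) (picard_lim a q w t)).
      apply is_lim_seq_picard; auto; lra. }
  apply (CVU_Derive (fun n => picard a (S n) w q) D).
  - apply open_and; [apply open_gt|apply open_lt].
  - unfold D; intros c d x Hc Hd Hx; lra.
  - apply CVU_dom_cauchy; intros eps.
    destruct (picard_CVU a (t + 1) w q cw cq w0 q0 eps) as [N HN].
    exists N; intros n m s Hs Hn Hm; apply HN; [unfold D in Hs; lra|lia|lia].
  - intros n s _; eexists; now apply is_derive_picard.
  - intros n s _; apply continuity_pt_filterlim.
    apply (continuous_ext (fun s => w s * picard a n q w s)).
    + intros; symmetry; apply DE.
    + now apply continuous_mul_picard.
  - apply CVU_dom_cauchy; intros eps.
    destruct (continuity_ab_maj w a (t + 1)) as [c [Hc _]]; [lra| |].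
    { intros s _; apply continuity_pt_filterlim, cw. }
    assert (Kpos : 0 < Rabs (w c) + 1) by (pose proof (Rabs_pos (w c)); lra).
    destruct (picard_CVU a (t + 1) q w cq cw q0 w0
      (mkposreal _ (Rdiv_lt_0_compat _ _ (cond_pos eps) Kpos))) as [N HN].
    exists N; intros n m s Hs Hn Hm; unfold D in Hs; rewrite !DE.
    rewrite <- Rmult_minus_distr_l, Rabs_mult.
    specialize (HN n m s ltac:(lra) Hn Hm); simpl in HN.
    pose proof (Hc s ltac:(lra)). pose proof (Rle_abs (w c)).
    rewrite (Rabs_pos_eq (w s)) by (apply w0; lra).
    replace (pos eps) with ((Rabs (w c) + 1) * (eps / (Rabs (w c) + 1)))
      by (field; lra).
    apply Rle_lt_trans
      with ((Rabs (w c) + 1) * Rabs (picard a n q w s - picard a m q w s)).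
    + apply Rmult_le_compat_r; [apply Rabs_pos|lra].
    + now apply Rmult_lt_compat_l.
  - unfold D; lra.
Qed.

(** Starting the iteration at a - 1 makes a an interior point, where the
    derivatives are two-sided. *)
Lemma ode_system_solution (a : R) (w q : R -> R) :
  (forall t, continuous w t) -> (forall t, continuous q t) ->
  (forall t, 0 <= w t) -> (forall t, 0 <= q t) ->
  exists x y : R -> R, forall t, a <= t ->
    is_derive x t (w t * y t) /\ is_derive y t (q t * x t) /\
    1 <= x t /\ 1 <= y t.
Proof.
  intros cw cq w0 q0.
  exists (picard_lim (a - 1) w q), (picard_lim (a - 1) q w); intros t Ht.
  repeat split; try apply is_derive_picard_lim; try apply picard_lim_ge1; auto; lra.
Qed.

(** * Comparison by derivatives *)

Lemma mean_value (f df : R -> R) (a t : R) : a <= t ->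
  (forall s, a <= s -> is_derive f s (df s)) ->
  exists c, a <= c /\ f t - f a = df c * (t - a).
Proof.
  intros Ht d; destruct (MVT_gen f a t df) as [c [Hc e]];
    try rewrite Rmin_left, Rmax_right by easy.
  - intros s Hs; apply d; lra.
  - intros s Hs; apply continuity_pt_filterlim; eapply is_derive_cont, d; lra.
  - exists c; split; [|easy]. rewrite Rmin_left in Hc; lra.
Qed.

Lemma nondecreasing_of_derive (f df : R -> R) (a t : R) : a <= t ->
  (forall s, a <= s -> is_derive f s (df s)) ->
  (forall s, a <= s -> 0 <= df s) -> f a <= f t.
Proof.
  intros Ht d d0; destruct (mean_value f df a t Ht d) as [c [Hc e]].
  assert (0 <= df c * (t - a)) by (apply Rmult_le_pos; [auto|lra]). lra.
Qed.

(** * Equivalence of the two divergence conditions *)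

(** The two sides have the same derivative (L - Q) w, where Q is the integral of
    q, and both vanish at a.  With L the total integral of q, the factor L - Q is
    the tail rho. *)
Lemma RInt_tail_by_parts (a L t : R) (w q : R -> R) :
  (forall t, continuous w t) -> (forall t, continuous q t) -> a <= t ->
  RInt (fun s => (L - RInt q a s) * w s) a t
  = (L - RInt q a t) * RInt w a t + RInt (fun s => q s * RInt w a s) a t.
Proof.
  intros cw cq Ht.
  assert (cA : forall s, continuous (fun s => (L - RInt q a s) * w s) s).
  { intros s; apply (continuous_mult (fun s => L - RInt q a s)); [|auto].
    apply (continuous_minus (fun _ => L)); [apply continuous_const|].
    now apply continuous_RInt_cont. }
  assert (cB : forall s, continuous (fun s => q s * RInt w a s) s)
    by now apply continuous_mult_RInt.
  destruct (mean_value (fun t => RInt (fun s => (L - RInt q a s) * w s) a t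
    - ((L - RInt q a t) * RInt w a t + RInt (fun s => q s * RInt w a s) a t))
    (fun _ => 0) a t Ht) as [c [_ e]].
  - intros s _; evar_last.
    + apply (is_derive_minus (RInt (fun s => (L - RInt q a s) * w s) a));
        [now apply is_derive_RInt_cont|].
      apply (is_derive_plus (fun s => (L - RInt q a s) * RInt w a s)
               (RInt (fun s => q s * RInt w a s) a));
        [|now apply (is_derive_RInt_cont (fun s => q s * RInt w a s))].
      apply (is_derive_mult (fun s => L - RInt q a s) (RInt w a)).
      * apply (is_derive_minus (fun _ => L) (RInt q a));
          [apply is_derive_const|now apply is_derive_RInt_cont].
      * now apply is_derive_RInt_cont.
      * intros; apply Rmult_comm.
    + unfold minus, plus, opp, mult, zero; simpl; ring_R.
  - rewrite !RInt_point in e; unfold zero in e; simpl in e; lra.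
Qed.

Lemma RInt_le_limit (a L t : R) (q : R -> R) :
  (forall t, continuous q t) -> (forall t, a <= t -> 0 <= q t) ->
  is_lim (RInt q a) p_infty L -> a <= t -> RInt q a t <= L.
Proof.
  intros cq q0 HL Ht.
  apply (is_lim_le_loc (fun _ => RInt q a t) (RInt q a) p_infty
    (RInt q a t) L); [|apply is_lim_const|easy].
  exists t; intros s Hs; apply RInt_cont_mono; auto; lra.
Qed.

(** Forward: the boundary term (L - Q(t)) W(t) is nonnegative.
    Backward: fix t with the integral of (L - Q) w over [a,t] above M + 1, then
    take s so large that (L - Q(s)) W(t) <= 1; since W >= W(t) on [t,s], the
    integral of q W over [a,s] is above M. *)
Lemma diverges_tail_iff (a L : R) (w q : R -> R) :
  (forall t, continuous w t) -> (forall t, continuous q t) ->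
  (forall t, a <= t -> 0 <= w t) -> (forall t, a <= t -> 0 <= q t) ->
  is_lim (RInt q a) p_infty L ->
  RInt_diverges (fun t => q t * RInt w a t) a <->
  RInt_diverges (fun t => (L - RInt q a t) * w t) a.
Proof.
  intros cw cq w0 q0 HL; unfold RInt_diverges; split; intros H.
  - refine (is_lim_le_p_loc _ _ _ _ H); exists a; intros t Ht.
    rewrite (RInt_tail_by_parts a L t w q) by (auto; lra).
    pose proof (RInt_le_limit a L t q cq q0 HL ltac:(lra)).
    pose proof (RInt_cont_nonneg w a t ltac:(lra) cw w0).
    pose proof (Rmult_le_pos (L - RInt q a t) (RInt w a t) ltac:(lra) ltac:(lra)).
    lra.
  - apply is_lim_spec; intros M.
    apply is_lim_spec in H; destruct (H (M + 1)) as [N HN].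
    set (t := Rmax a N + 1).
    assert (Ht : a <= t /\ N < t).
    { unfold t; pose proof (Rmax_l a N); pose proof (Rmax_r a N); lra. }
    destruct Ht as [Ht Nt]; specialize (HN t Nt).
    rewrite (RInt_tail_by_parts a L t w q) in HN by auto.
    pose proof (RInt_cont_nonneg w a t Ht cw w0) as W0.
    pose proof (fun s => RInt_le_limit a L s q cq q0 HL) as QL.
    set (W := RInt w a t) in *.
    assert (Wpos : 0 < W + 1) by lra.
    apply is_lim_spec in HL.
    (* 1/(W + 1) rather than 1/W, since W(t) may vanish. *)
    destruct (HL (mkposreal _ (Rinv_0_lt_compat _ Wpos))) as [N' HN'].
    exists (Rmax t N'); intros s Hs.
    pose proof (Rmax_l t N'); pose proof (Rmax_r t N').
    specialize (HN' s ltac:(lra)); simpl in HN'.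
    apply Rabs_lt_between in HN'.
    assert (cB : forall s, continuous (fun s => q s * RInt w a s) s)
      by now apply continuous_mult_RInt.
    assert (grow : W * (RInt q a s - RInt q a t) <=
      RInt (fun s => q s * RInt w a s) a s - RInt (fun s => q s * RInt w a s) a t).
    { set (F := fun r => RInt (fun s => q s * RInt w a s) a r - W * RInt q a r).
      assert (F t <= F s); [|unfold F in *; lra].
      apply (nondecreasing_of_derive F (fun r => q r * RInt w a r - W * q r));
        [lra| |].
      - intros r _; apply (is_derive_minus (RInt (fun s => q s * RInt w a s) a)).
        + now apply (is_derive_RInt_cont (fun s => q s * RInt w a s)).
        + apply (is_derive_scal (RInt q a)); now apply is_derive_RInt_cont.
      - intros r Hr; pose proof (q0 r ltac:(lra)).
        pose proof (RInt_cont_mono w a t r ltac:(lra) cw w0) as Wr; fold W in Wr.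
        replace (q r * RInt w a r - W * q r) with (q r * (RInt w a r - W)) by ring.
        apply Rmult_le_pos; lra. }
    assert (W * (L - RInt q a s) <= 1).
    { apply Rle_trans with ((W + 1) * / (W + 1)); [|right; field; lra].
      apply Rmult_le_compat; try lra.
      pose proof (QL s ltac:(lra)). lra. }
    lra.
Qed.

(** * Growth of solutions with positive data *)

(** From y >= 1 comes x' = w y >= w, whence x >= W; then y' = q x >= q W. *)
Lemma solution_lower_bounds (a t : R) (w q x y : R -> R) :
  (forall t, continuous w t) -> (forall t, continuous q t) ->
  (forall t, a <= t -> 0 <= w t) -> (forall t, a <= t -> 0 <= q t) ->
  (forall t, a <= t -> is_derive x t (w t * y t)) ->
  (forall t, a <= t -> is_derive y t (q t * x t)) ->
  (forall t, a <= t -> 1 <= x t) -> (forall t, a <= t -> 1 <= y t) ->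
  a <= t ->
  RInt w a t <= x t /\ RInt (fun s => q s * RInt w a s) a t <= y t.
Proof.
  intros cw cq w0 q0 dx dy x1 y1.
  assert (X : forall t, a <= t -> RInt w a t <= x t).
  { intros s Hs.
    pose proof (nondecreasing_of_derive (fun r => x r - RInt w a r)
      (fun r => w r * y r - w r) a s Hs) as D; cbv beta in D.
    rewrite RInt_point in D; unfold zero in D; simpl in D.
    pose proof (x1 a (Rle_refl a)).
    enough (x a - 0 <= x s - RInt w a s) by lra; apply D.
    - intros r Hr; apply (is_derive_minus x (RInt w a)); [auto|].
      now apply is_derive_RInt_cont.
    - intros r Hr; pose proof (w0 r Hr); pose proof (y1 r Hr).
      pose proof (Rmult_le_compat_l (w r) 1 (y r)). lra. }
  intros Ht; split; [auto|].
  pose proof (nondecreasing_of_derive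
    (fun r => y r - RInt (fun s => q s * RInt w a s) a r)
    (fun r => q r * x r - q r * RInt w a r) a t Ht) as D; cbv beta in D.
  rewrite RInt_point in D; unfold zero in D; simpl in D.
  pose proof (y1 a (Rle_refl a)).
  enough (y a - 0 <= y t - RInt (fun s => q s * RInt w a s) a t) by lra; apply D.
  - intros r Hr; apply (is_derive_minus y (RInt (fun s => q s * RInt w a s) a));
      [auto|].
    apply (is_derive_RInt_cont (fun s => q s * RInt w a s)).
    now apply continuous_mult_RInt.
  - intros r Hr; pose proof (q0 r Hr); pose proof (X r Hr).
    pose proof (Rmult_le_compat_l (q r) (RInt w a r) (x r)). lra.
Qed.

(** * Passage from the half-line to the whole line *)

(** Constant continuation to the left of [a], which turns continuity relative
    to the half-line into continuity on the whole line. *)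
Definition extend (a : R) (f : R -> R) (t : R) : R := f (Rmax a t).

Lemma extend_eq (a t : R) (f : R -> R) : a <= t -> extend a f t = f t.
Proof. intros; unfold extend; now rewrite Rmax_right. Qed.

Lemma continuous_extend (a : R) (f : R -> R) :
  continuous_on (ray a) f -> forall t, continuous (extend a f) t.
Proof.
  intros cf t; unfold continuous, extend.
  apply (filterlim_comp _ _ _ (Rmax a) f (locally t)
    (within (ray a) (locally (Rmax a t)))); [|apply cf, Rmax_l].
  intros P [eps HP]; exists eps; intros s Hs.
  apply HP; [|apply Rmax_l].
  change (Rabs (s - t) < eps) in Hs; change (Rabs (Rmax a s - Rmax a t) < eps).
  unfold Rmax, Rabs in *; repeat destruct Rle_dec; repeat destruct Rcase_abs; lra.
Qed.

Lemma D_in_ray (f g d : R -> R) (a t l : R) : a <= t ->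
  is_derive f t l -> (forall s, a <= s -> g s = f s) -> d t = l ->
  D_in g d (ray a) t.
Proof.
  intros Ht df gf dt eps Heps.
  apply is_derive_Reals in df.
  destruct (df eps Heps) as [delta Hd]; exists delta; split; [apply cond_pos|].
  intros s [[Hs st] Hst]; simpl in *; unfold R_dist, Rdist in *; unfold ray in Hs.
  rewrite !gf, dt by easy.
  specialize (Hd (s - t) ltac:(lra) Hst).
  now replace (t + (s - t)) with s in Hd by ring.
Qed.

Lemma RInt_diverges_ext (f g : R -> R) (a : R) :
  (forall t, a <= t -> f t = g t) -> RInt_diverges f a <-> RInt_diverges g a.
Proof.
  intros fg; split; apply is_lim_ext_loc; exists a; intros t Ht;
    apply RInt_ext; intros s Hs; rewrite Rmin_left in Hs by lra;
    [|symmetry]; apply fg; lra.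
Qed.

Lemma RInt_extend (a t : R) (f : R -> R) : a <= t ->
  RInt (extend a f) a t = RInt f a t.
Proof.
  intros Ht; apply RInt_ext; intros s Hs; rewrite Rmin_left in Hs by easy.
  apply extend_eq; lra.
Qed.

Lemma is_RInt_gen_rho (a : R) (f : R -> R) : RInt_converges f a ->
  is_RInt_gen f (at_point a) (Rbar_locally p_infty) (rho f a).
Proof. exact (RInt_gen_correct (V := R_CompleteNormedModule) f). Qed.

Lemma is_lim_RInt_rho (a : R) (f : R -> R) :
  RInt_converges f a -> is_lim (RInt f a) p_infty (rho f a).
Proof.
  intros H P HP; destruct (is_RInt_gen_rho a f H P HP) as [A B HA [N HN] HAB].
  exists N; intros t Ht; destruct (HAB a t HA (HN t Ht)) as [l [Il Pl]].
  simpl in Il; now rewrite (is_RInt_unique _ _ _ _ Il).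
Qed.

Lemma rho_eq (a t : R) (q : R -> R) :
  continuous_on (ray a) q -> RInt_converges q a ->
  a <= t -> rho q t = rho q a - RInt q a t.
Proof.
  intros cq H Ht.
  enough (G : is_RInt_gen q (at_point t) (Rbar_locally p_infty)
      (rho q a - RInt q a t))
    by exact (is_RInt_gen_unique (V := R_CompleteNormedModule) q _ G).
  replace (rho q a - RInt q a t) with (plus (opp (RInt q a t)) (rho q a))
    by (unfold plus, opp; simpl; ring_R).
  apply (is_RInt_gen_Chasles q a); [|now apply is_RInt_gen_rho].
  apply is_RInt_gen_at_point, (is_RInt_swap (V := R_NormedModule)).
  apply (RInt_correct (V := R_CompleteNormedModule)).
  apply (ex_RInt_ext (V := R_NormedModule) (extend a q)).
  - intros s Hs; rewrite Rmin_left in Hs by easy; apply extend_eq; lra.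
  - now apply ex_RInt_cont, continuous_extend.
Qed.

Theorem theorem4p2 (a : R) (p q : R -> R)
  (a_ge0 : 0 <= a)
  (p_pos : forall t, a <= t -> 0 < p t)
  (q_pos : forall t, a <= t -> 0 < q t)
  (p_cont : continuous_on (ray a) p)
  (q_cont : continuous_on (ray a) q)
  (p_int : RInt_diverges (fun t => / p t) a)
  (q_int : RInt_converges q a) :
  (RInt_diverges (fun t => q t * Pint p a t) a <->
   RInt_diverges (fun t => rho q t / p t) a) /\
  (RInt_diverges (fun t => q t * Pint p a t) a ->
   forall gamma : R, 0 < gamma < 1 ->
   (exists t0, forall t, t0 <= t -> a <= t ->
      RInt (fun s => q s * Pint p a s ^ 2) a t <= gamma * Pint p a t) ->
   exists (T : R) (x x' : R -> R),
     a <= T /\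
     is_solution p q T x x' /\
     (forall t, T <= t -> 0 < x t) /\
     is_lim x p_infty p_infty /\
     is_lim (quasi_derivative p x') p_infty p_infty).
Proof.
  set (v := extend a q).
  set (w := extend a (fun t => / p t)).
  assert (cv : forall t, continuous v t) by now apply continuous_extend.
  assert (cw : forall t, continuous w t).
  { intros t; apply (continuous_comp (extend a p) Rinv).
    - now apply continuous_extend.
    - apply continuous_Rinv, Rgt_not_eq, p_pos, Rmax_l. }
  assert (v0 : forall t, 0 <= v t) by (intros t; left; apply q_pos, Rmax_l).
  assert (w0 : forall t, 0 <= w t).
  { intros t; left; apply Rinv_0_lt_compat, p_pos, Rmax_l. }
  assert (vE : forall t, a <= t -> v t = q t) by (intros; now apply extend_eq).
  assert (wE : forall t, a <= t -> w t = / p t)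
    by (intros; now apply (extend_eq a t (fun t => / p t))).
  assert (PE : forall t, a <= t -> Pint p a t = RInt w a t)
    by (intros; symmetry; now apply RInt_extend).
  assert (HL : is_lim (RInt v a) p_infty (rho q a)).
  { apply is_lim_ext_loc with (RInt q a); [|now apply is_lim_RInt_rho].
    exists a; intros t Ht; symmetry; apply RInt_extend; lra. }
  assert (qP : RInt_diverges (fun t => q t * Pint p a t) a <->
               RInt_diverges (fun t => v t * RInt w a t) a).
  { apply RInt_diverges_ext; intros t Ht; now rewrite vE, PE. }
  split.
  - rewrite qP, (diverges_tail_iff a (rho q a) w v) by auto.
    apply RInt_diverges_ext; intros t Ht.
    rewrite (rho_eq a t q), wE by easy.
    unfold v; now rewrite RInt_extend.
  - rewrite qP; intros H _ _ _.
    destruct (ode_system_solution a w v) as [x [y xy]]; auto.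
    assert (bounds : forall t, a <= t ->
      RInt w a t <= x t /\ RInt (fun s => v s * RInt w a s) a t <= y t).
    { intros t Ht; apply solution_lower_bounds; auto; intros s Hs; now apply xy. }
    assert (pE : forall t, a <= t -> quasi_derivative p (fun t => y t / p t) t = y t).
    { intros t Ht; unfold quasi_derivative; field.
      now apply Rgt_not_eq, p_pos. }
    exists a, x, (fun t => y t / p t); repeat split.
    + lra.
    + intros t Ht; apply (D_in_ray x _ _ _ _ (w t * y t)); try easy; [now apply xy|].
      rewrite wE by easy; apply Rmult_comm.
    + intros t Ht; apply (D_in_ray y _ _ _ _ (v t * x t)); try easy; [now apply xy|].
      now rewrite vE.
    + exists a; split; [lra|]. destruct (xy a) as [_ [_ [h _]]]; lra.
    + intros t Ht; destruct (xy t Ht) as [_ [_ [h _]]]; lra.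
    + refine (is_lim_le_p_loc _ _ _ _ p_int); exists a; intros t Ht.
      change (Pint p a t <= x t); rewrite PE by lra; apply bounds; lra.
    + refine (is_lim_le_p_loc _ _ _ _ H); exists a; intros t Ht.
      rewrite pE by lra; apply bounds; lra.
Qed.
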